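(* As $n\to\infty$ over the positive integers, \[ \sum_{k=0}^n\binom{2k}{k} = \frac{4^{n+1}}{3\sqrt{\pi n}} \left(1+\frac{1}{24\,n}+\frac{59}{384\,n^2}+\frac{2425}{9216\,n^3}+O(n^{-4})\right). \] *)

(* Defs.v *)
From HB Require Import structures.
From mathcomp Require Export all_boot all_order all_algebra.
From mathcomp Require Export all_classical all_reals all_analysis.
Export Order.TTheory GRing.Theory Num.Theory numFieldNormedType.Exports.

Set Implicit Arguments.
Unset Strict Implicit.
Unset Printing Implicit Defensive.

(* Main.v *)
Require Import Defs.
From mathcomp Require Import ring lra zify.

(** Write S_n for the sum, p_n = C(2n,n) / 4^n ([central_ratio]) and
    r_n = (3/4) S_n / C(2n,n) ([sum_ratio]).  Then

      S_n * 3 sqrt(pi n) / 4^(n+1) = (sqrt(pi n) p_n) * r_n,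

    and each factor has an expansion in powers of 1/n with an explicit error
    term of order n^-4; the theorem is the product of the two expansions.

    The factor sqrt(pi n) p_n.  With x = 4n+1, Brouncker's continued fraction
    gives 4 / (pi p_n^2) = x + 1/(2x + 9/(2x + 25/(2x + ...))).  Only the
    convergents x + 1/(2x) and x + 1/(2x + 9/(2x)) are used, whose relative
    difference is already of order n^-4.  Multiplied by pi p_n^2 the first one
    gives a nonincreasing sequence and the second a nondecreasing one, because
    p_(n+1) / p_n = (2n+1) / (2n+2) is rational and the two step inequalities
    reduce to the positivity of the constants 36 and 2700.  Both sequences tend
    to 4 by Wallis' inequalities 2/(2n+1) <= pi p_n^2 <= 1/n, so 4 lies between
    them ([brouncker1_lower], [brouncker2_upper]).  Taking a square root gives
    [central_ratio_expansion].

    The factor r_n.  Since S_(n+1) = S_n + C(2n+2,n+1), the sequence r_n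
    satisfies r_(n+1) = 3/4 + (n+1) / (2(2n+1)) * r_n.  The linear part is a
    contraction by at most 1/3, so a truncated expansion that satisfies the
    recurrence up to order n^-4 approximates r_n up to order n^-4
    ([sum_ratio_expansion]).

    Wallis' inequalities come from W_n, the integral of sin^n over
    [0, pi/2]: it decreases in n and satisfies (n+1) W_n W_(n+1) = pi/2 and
    W_(2n) = p_n pi/2.  It is handled through an explicit antiderivative of
    sin^n, so that no integration theory is involved. *)

Set Implicit Arguments.
Unset Strict Implicit.
Unset Printing Implicit Defensive.

Local Open Scope classical_set_scope.
Local Open Scope ring_scope.

(** * Wallis' inequalities *)

(** An antiderivative of sin^n: the recursion is the reduction formula obtained
    from sin^(m+1) = sin^(m-1) - sin^(m-1) cos^2 by parts. *)
Fixpoint sin_primitive {R : realType} (n : nat) (x : R) : R :=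
  match n with
  | 0 => x
  | 1 => - cos x
  | (k.+1 as m).+1 =>
      (m%:R * sin_primitive k x - sin x ^+ m * cos x) / m.+1%:R
  end.

Lemma is_derive_sin_primitive (R : realType) (n : nat) (x : R) :
  is_derive x 1 (sin_primitive n) (sin x ^+ n).
Proof.
have [] : is_derive x 1 (@sin_primitive R n) (sin x ^+ n) /\
          is_derive x 1 (@sin_primitive R n.+1) (sin x ^+ n.+1) => //.
elim: n => [|n [IH0 IH1]]; split => //.
- by rewrite expr0 /=; exact: is_derive_id.
- by rewrite expr1 /= -[sin x]opprK; exact: is_deriveN.
- have -> : @sin_primitive R n.+2 =
      n.+2%:R^-1 *: (n.+1%:R *: @sin_primitive R n - (@sin R ^+ n.+1) * (@cos R)).
    by apply/funext => z; rewrite !fctE /= [LHS]mulrC.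
  apply: is_derive_eq.
  rewrite /GRing.scale /= !fctE.
  have := cos2Dsin2 x; move: (sin x) (cos x) => s c sc.
  have -> : c * (n.+1%:R * s ^+ n * c) = n.+1%:R * s ^+ n * (1 - s ^+ 2).
    by rewrite -sc; ring.
  rewrite !exprS -[n.+2%:R]natr1.
  field.
  by apply: lt0r_neq0; have := ler0n R n; lra.
Qed.

(** The Wallis integral of sin^n over [0, pi/2]. *)
Definition wallis (R : realType) (n : nat) : R :=
  sin_primitive n (pi / 2) - sin_primitive n 0.

Lemma wallis0 (R : realType) : wallis R 0 = pi / 2.
Proof. by rewrite /wallis /= subr0. Qed.

Lemma wallis1 (R : realType) : wallis R 1 = 1.
Proof. by rewrite /wallis /= cos_pihalf cos0 oppr0 opprK add0r. Qed.

(** The boundary term sin^(n+1) cos of the reduction formula vanishes at both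
    ends of the quadrant. *)
Lemma wallis_rec (R : realType) (n : nat) :
  n.+2%:R * wallis R n.+2 = n.+1%:R * wallis R n.
Proof.
rewrite /wallis /= cos_pihalf sin0 cos0 expr0n mulr0 mul0r !subr0.
by field; apply: lt0r_neq0; have := ler0n R n; lra.
Qed.

(** By [wallis_rec] the left-hand side does not depend on n. *)
Lemma wallis_mul_succ (R : realType) (n : nat) :
  n.+1%:R * (wallis R n * wallis R n.+1) = pi / 2.
Proof.
elim: n => [|n IHn]; first by rewrite wallis0 wallis1 mulr1 mul1r.
by rewrite mulrCA wallis_rec mulrCA [wallis R n.+1 * _]mulrC.
Qed.

Lemma le_of_is_derive (R : realType) (f df : R -> R) (a b : R) : a <= b ->
  (forall x : R, is_derive x 1 f (df x)) ->
  (forall x, a <= x <= b -> 0 <= df x) -> f a <= f b.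
Proof.
move=> ab fdf df0.
have cf : {within `[a, b], continuous f}.
  apply: continuous_subspaceT => x; apply: differentiable_continuous.
  by apply/derivable1_diffP; have [] := fdf x.
have [c cab fba] := MVT_segment ab (fun x _ => fdf x) cf.
by rewrite -subr_ge0 fba mulr_ge0 ?subr_ge0// df0// -in_itv.
Qed.

Lemma sin_ge0_quadrant (R : realType) (x : R) : 0 <= x <= pi / 2 -> 0 <= sin x.
Proof.
move=> /andP[x0 x1]; apply: sin_ge0_pi; rewrite x0 (le_trans x1)//.
by have := pi_ge0 R; lra.
Qed.

Lemma wallis_ge0 (R : realType) (n : nat) : 0 <= wallis R n.
Proof.
have pi0 : 0 <= pi / 2 :> R by have := pi_ge0 R; lra.
rewrite subr_ge0.
apply: (le_of_is_derive pi0 (is_derive_sin_primitive n)) => x x01.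
by rewrite exprn_ge0// sin_ge0_quadrant.
Qed.

Lemma wallis_decr (R : realType) (n : nat) : wallis R n.+1 <= wallis R n.
Proof.
have pi0 : 0 <= pi / 2 :> R by have := pi_ge0 R; lra.
suff : (@sin_primitive R n - @sin_primitive R n.+1) 0 <=
       (@sin_primitive R n - @sin_primitive R n.+1) (pi / 2).
  by rewrite /wallis !fctE; lra.
apply: (le_of_is_derive pi0) => [x|x x01].
  exact: (is_deriveB (is_derive_sin_primitive n x)
                     (is_derive_sin_primitive n.+1 x)).
have s0 := sin_ge0_quadrant x01.
by rewrite /= exprS -[X in X - _]mul1r -mulrBl mulr_ge0 ?exprn_ge0.
Qed.

Definition central_ratio (R : realType) (n : nat) : R :=
  'C(2 * n, n)%:R / 4 ^+ n.

Lemma central_bin_rec (R : realType) (n : nat) :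
  n.+1%:R * 'C(2 * n.+1, n.+1)%:R = 2 * (2 * n%:R + 1) * 'C(2 * n, n)%:R :> R.
Proof.
have E : (n.+1 * 'C(2 * n.+1, n.+1) = 2 * (2 * n).+1 * 'C(2 * n, n))%N.
  apply/eqP; rewrite -(eqn_pmul2l (ltn0Sn n)); apply/eqP.
  rewrite mulnS add2n -mul_bin_diag /=.
  have := mul_bin_left (2 * n).+1 n; have := mul_bin_down (2 * n).+1 n => /=.
  have -> : ((2 * n).+1 - n = n.+1)%N by lia.
  nia.
by rewrite -natrM E !natrM -[(2 * n).+1%:R]natr1 natrM.
Qed.

Lemma central_ratio_rec (R : realType) (n : nat) :
  central_ratio R n.+1 =
  (2 * n%:R + 1) / (2 * (n%:R + 1)) * central_ratio R n.
Proof.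
have n10 : n.+1%:R != 0 :> R by rewrite pnatr_eq0.
rewrite /central_ratio; apply: (mulfI n10).
rewrite [LHS]mulrA central_bin_rec exprS -[n.+1%:R]natr1.
by field; rewrite natr1 n10 expf_neq0// pnatr_eq0.
Qed.

Lemma wallis_even (R : realType) (n : nat) :
  wallis R (2 * n) = central_ratio R n * (pi / 2).
Proof.
elim: n => [|n IHn].
  by rewrite muln0 wallis0 /central_ratio muln0 bin0 expr0 divr1 mul1r.
have n20 : (2 * n).+2%:R != 0 :> R by rewrite pnatr_eq0.
apply: (mulfI n20); rewrite mulnS add2n wallis_rec IHn central_ratio_rec.
rewrite -[(2 * n).+2%:R]natr1 -[(2 * n).+1%:R]natr1 natrM.
field.
by apply: lt0r_neq0; have := ler0n R n; lra.
Qed.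

(** W_(2n)^2 lies between W_(2n) W_(2n+1) and W_(2n-1) W_(2n), both known by
    [wallis_mul_succ], while W_(2n) = p_n pi/2. *)
Lemma central_ratio_sqr_bounds (R : realType) (n : nat) : (0 < n)%N ->
  2 / (2 * n%:R + 1) <= pi * central_ratio R n ^+ 2 <= n%:R^-1.
Proof.
case: n => // n _; set p := central_ratio R n.+1.
have pi0 := pi_gt0 R.
have WE : wallis R (2 * n).+2 = p * (pi / 2).
  by rewrite -wallis_even mulnS add2n.
have H1 := wallis_mul_succ R (2 * n).+1.
have H2 := wallis_mul_succ R (2 * n).+2.
have d1 := wallis_decr R (2 * n).+1.
have d2 := wallis_decr R (2 * n).+2.
have w0 := wallis_ge0 R (2 * n).+2.
have n0 : 0 < n.+1%:R :> R by rewrite ltr0n.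
have e2 : (2 * n).+2%:R = 2 * n.+1%:R :> R by rewrite -natrM mulnS.
have e3 : (2 * n).+3%:R = 2 * n.+1%:R + 1 :> R by rewrite -natr1 e2.
rewrite e2 in H1; rewrite e3 in H2.
have n1 : 0 < 2 * n.+1%:R + 1 :> R by lra.
rewrite -[X in _ && (_ <= X)]mul1r ler_pdivrMr// ler_pdivlMr//.
have m1 := ler_wpM2r w0 d1.
have m2 := ler_wpM2l w0 d2.
rewrite WE in H1 H2 m1 m2.
have k1 := ler_wpM2l (ltW n0) m1.
have k2 := ler_wpM2l (ltW n1) m2.
by apply/andP; split; rewrite -(ler_pM2r pi0); lra.
Qed.

(** * Convergents of Brouncker's continued fraction *)

(** If u n < l, then u stays at least l - u n below l from n on, which the rate
    c/m forbids once m is large. *)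
Lemma nonincreasing_ge_of_inv (R : realType) (u : nat -> R) (l c : R) :
  (forall n, (0 < n)%N -> u n.+1 <= u n) ->
  (forall n, (0 < n)%N -> l - c / n%:R <= u n) ->
  forall n, (0 < n)%N -> l <= u n.
Proof.
move=> decr near_l n n0; rewrite leNgt; apply/negP => un_lt.
have e0 : 0 < l - u n by rewrite subr_gt0.
have decrD k : u (k + n)%N <= u n.
  elim: k => // k; apply: le_trans; rewrite addSn.
  by apply: decr; rewrite addn_gt0 n0 orbT.
pose m := (Num.bound `|c / (l - u n)| + n)%N.
have m0 : 0 < m%:R :> R by rewrite ltr0n addn_gt0 n0 orbT.
have : c / (l - u n) < m%:R.
  rewrite (le_lt_trans (ler_norm _))// (lt_le_trans (archi_boundP _))//.
  by rewrite ler_nat leq_addr.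
rewrite ltr_pdivrMr// mulrC -ltr_pdivrMr// => cm.
have := near_l m; rewrite -(ltr0n R) => /(_ m0).
by have := decrD (Num.bound `|c / (l - u n)|); rewrite -/m; lra.
Qed.

(** Two successive convergents of x + 1/(2x + 9/(2x + 25/(2x + ...))), which
    equals 4 (Gamma((x+3)/4) / Gamma((x+1)/4))^2. *)
Definition brouncker1 (R : realType) (x : R) : R := x + 1 / (2 * x).

Definition brouncker2 (R : realType) (x : R) : R := x + 1 / (2 * x + 9 / (2 * x)).

Lemma brouncker2E (R : realType) (x : R) : 0 < x ->
  brouncker2 x = x * (4 * x ^+ 2 + 11) / (4 * x ^+ 2 + 9).
Proof.
move=> x0; rewrite /brouncker2; field.
by do ?[apply/andP; split]; apply: lt0r_neq0; nra.
Qed.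

(** The full continued fraction b satisfies b(x) = ((x+1)/(x+3))^2 b(x+4), where
    x -> x+4 corresponds to n -> n+1; a convergent satisfies it up to a term of
    constant sign, which alternates with the order of the convergent. *)
Lemma brouncker1_step (R : realType) (x : R) : 0 < x ->
  ((x + 1) / (x + 3)) ^+ 2 * brouncker1 (x + 4) <= brouncker1 x.
Proof.
move=> x0; rewrite -subr_ge0.
have -> : brouncker1 x - ((x + 1) / (x + 3)) ^+ 2 * brouncker1 (x + 4) =
          36 / (2 * x * (x + 4) * (x + 3) ^+ 2).
  rewrite /brouncker1; field.
  by do ?[apply/andP; split]; apply: lt0r_neq0; lra.
by apply: divr_ge0; rewrite ?mulr_ge0 ?exprn_ge0//; lra.
Qed.

Lemma brouncker2_step (R : realType) (x : R) : 0 < x ->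
  brouncker2 x <= ((x + 1) / (x + 3)) ^+ 2 * brouncker2 (x + 4).
Proof.
move=> x0; rewrite -subr_ge0 !brouncker2E//; last by lra.
set d := 4 * x ^+ 2 + 9; set d' := 4 * (x + 4) ^+ 2 + 9.
have d0 : 0 < d by rewrite /d; nra.
have d'0 : 0 < d' by rewrite /d'; nra.
rewrite (_ : _ - _ = 2700 / ((x + 3) ^+ 2 * d * d')).
  apply: divr_ge0; first exact: ler0n.
  apply: mulr_ge0; last exact: ltW.
  apply: mulr_ge0; [exact: sqr_ge0|exact: ltW].
rewrite /d /d' in d0 d'0 *; field.
by rewrite !lt0r_neq0//; lra.
Qed.

Lemma central_ratio_sqr_rec (R : realType) (n : nat) (x : R) :
  x = 4 * n%:R + 1 ->
  pi * central_ratio R n.+1 ^+ 2 =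
  ((x + 1) / (x + 3)) ^+ 2 * (pi * central_ratio R n ^+ 2).
Proof.
move=> ->; rewrite central_ratio_rec.
field.
by do ?[apply/andP; split]; apply: lt0r_neq0; have := ler0n R n; lra.
Qed.

(** The left factor times the convergent is nonincreasing in n, and Wallis'
    lower bound shows that it is at least 4 - 1/n. *)
Lemma brouncker1_lower (R : realType) (n : nat) : (0 < n)%N ->
  4 <= pi * central_ratio R n ^+ 2 * brouncker1 (4 * n%:R + 1).
Proof.
move: n; apply: (@nonincreasing_ge_of_inv _ _ _ 1) => n n0.
  have n0R := ler0n R n.
  rewrite (central_ratio_sqr_rec (erefl (4 * n%:R + 1))).
  rewrite -[leLHS]mulrA [leLHS]mulrCA ler_wpM2l//.
    by rewrite mulr_ge0 ?sqr_ge0 ?pi_ge0.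
  have <- : 4 * n%:R + 1 + 4 = 4 * n.+1%:R + 1 :> R by rewrite -natr1; ring.
  by rewrite brouncker1_step//; lra.
have n0R : 0 < n%:R :> R by rewrite ltr0n.
have /andP[lo _] := central_ratio_sqr_bounds R n0.
apply: (@le_trans _ _ (2 / (2 * n%:R + 1) * (4 * n%:R + 1))).
  rewrite -subr_ge0.
  have -> : 2 / (2 * n%:R + 1) * (4 * n%:R + 1) - (4 - 1 / n%:R) =
            1 / (n%:R * (2 * n%:R + 1)) :> R.
    by field; rewrite !lt0r_neq0//; lra.
  by apply: divr_ge0; rewrite ?mulr_ge0//; lra.
apply: ler_pM => //.
rewrite /brouncker1 lerDl; apply: divr_ge0; lra.
Qed.

(** Dual to [brouncker1_lower], for the opposite sequence: Wallis' upper bound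
    and [brouncker2 x <= x + 1] give at most 4 + 2/n. *)
Lemma brouncker2_upper (R : realType) (n : nat) : (0 < n)%N ->
  pi * central_ratio R n ^+ 2 * brouncker2 (4 * n%:R + 1) <= 4.
Proof.
move=> n0; rewrite -lerN2; move: n n0.
apply: (@nonincreasing_ge_of_inv _ _ _ 2) => n n0; first rewrite lerN2.
  have n0R := ler0n R n.
  rewrite (central_ratio_sqr_rec (erefl (4 * n%:R + 1))).
  rewrite -[leRHS]mulrA [leRHS]mulrCA ler_wpM2l//.
    by rewrite mulr_ge0 ?sqr_ge0 ?pi_ge0.
  have <- : 4 * n%:R + 1 + 4 = 4 * n.+1%:R + 1 :> R by rewrite -natr1; ring.
  by rewrite brouncker2_step//; lra.
have n0R : 0 < n%:R :> R by rewrite ltr0n.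
have /andP[_ hi] := central_ratio_sqr_bounds R n0.
have x0 : 0 < 4 * n%:R + 1 :> R by lra.
have b2 : brouncker2 (4 * n%:R + 1) <= 4 * n%:R + 2 :> R.
  rewrite (_ : 4 * n%:R + 2 = 4 * n%:R + 1 + 1); last by ring.
  have q0 : 0 < 9 / (2 * (4 * n%:R + 1)) :> R by rewrite divr_gt0//; lra.
  by rewrite lerD2l ler_pdivrMr; lra.
suff : pi * central_ratio R n ^+ 2 * brouncker2 (4 * n%:R + 1) <= 4 + 2 / n%:R.
  by lra.
rewrite (_ : 4 + 2 / n%:R = n%:R^-1 * (4 * n%:R + 2)); last first.
  by field; exact: lt0r_neq0.
apply: ler_pM => //; first by rewrite mulr_ge0 ?sqr_ge0 ?pi_ge0.
by rewrite brouncker2E// divr_ge0 ?mulr_ge0//; nra.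
Qed.

(** * Expansion of the central binomial coefficient *)

(** Truncated expansion of sqrt(pi n) p_n in the variable z = 1/(8n), which
    keeps the coefficients small: in terms of n it reads
    1 - 1/(8n) + 1/(128n^2) + 5/(1024n^3). *)
Definition central_expansion (R : realType) (z : R) : R :=
  1 - z + z ^+ 2 / 2 + 5 / 2 * z ^+ 3.

Lemma powers_le1 (R : realType) (y : R) : 0 <= y <= 1 ->
  [/\ 0 <= y ^+ 2 <= 1, 0 <= y ^+ 3 <= 1 & 0 <= y ^+ 4 <= 1].
Proof.
by move=> /andP[y0 y1]; split; rewrite exprn_ge0// exprn_ile1.
Qed.

Lemma central_expansion_ge (R : realType) (z : R) : 0 <= z <= 1 / 8 ->
  7 / 8 <= central_expansion z.
Proof.
move=> z01; have [|z2 z3 _] := @powers_le1 _ z; first by lra.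
by rewrite /central_expansion; lra.
Qed.

(** In terms of z the right-hand side is (1+2z)/(1+4z+6z^2), whose expansion
    agrees with the square of [central_expansion] through order 3; the next
    coefficient of the difference is -93/4, whence the 24. *)
Lemma brouncker1_expansion (R : realType) (n z : R) : 1 <= n ->
  z = 1 / (8 * n) ->
  central_expansion z ^+ 2 - 24 * z ^+ 4 <= 4 * n / brouncker1 (4 * n + 1).
Proof.
move=> n1 zE.
have z0 : 0 < z by rewrite zE divr_gt0//; lra.
have z1 : z <= 1 / 8 by rewrite zE ler_pdivrMr; lra.
have -> : 4 * n / brouncker1 (4 * n + 1) = (1 + 2 * z) / (1 + 4 * z + 6 * z ^+ 2).
  rewrite zE /brouncker1; field.
  by do ?[apply/andP; split]; apply: lt0r_neq0; nra.
have [|z2 z3 z4] := @powers_le1 _ z; first by lra.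
rewrite ler_pdivlMr; last by lra.
rewrite -subr_ge0 /central_expansion.
rewrite (_ : _ - _ = z ^+ 4 * (3 / 4 + 177 / 2 * z + 625 / 4 * z ^+ 2
                              - 40 * z ^+ 3 - 75 / 2 * z ^+ 4)).
  have w3 : z ^+ 3 <= z by rewrite exprSr ler_piMl//; lra.
  have w4 : z ^+ 4 <= z by rewrite exprSr ler_piMl//; lra.
  by apply: mulr_ge0; lra.
by field.
Qed.

(** The left-hand side is (1+4z+13z^2)/(1+6z+23z^2+30z^3), again matching the
    square of [central_expansion] through order 3. *)
Lemma brouncker2_expansion (R : realType) (n z : R) : 1 <= n ->
  z = 1 / (8 * n) ->
  4 * n / brouncker2 (4 * n + 1) <= central_expansion z ^+ 2 + 24 * z ^+ 4.
Proof.
move=> n1 zE.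
have z0 : 0 < z by rewrite zE divr_gt0//; lra.
have z1 : z <= 1 / 8 by rewrite zE ler_pdivrMr; lra.
have [|z2 z3 z4] := @powers_le1 _ z; first by lra.
have -> : 4 * n / brouncker2 (4 * n + 1) =
  (1 + 4 * z + 13 * z ^+ 2) / (1 + 6 * z + 23 * z ^+ 2 + 30 * z ^+ 3).
  rewrite brouncker2E; last by lra.
  rewrite zE; field.
  by do ?[apply/andP; split]; apply: lt0r_neq0; nra.
rewrite ler_pdivrMr; last by lra.
rewrite -subr_ge0 /central_expansion.
rewrite (_ : _ - _ = z ^+ 4 * (117 / 4 + 270 * z + 584 * z ^+ 2
  + 1345 / 2 * z ^+ 3 + 875 / 4 * z ^+ 4 + 375 / 2 * z ^+ 5)).
  apply: mulr_ge0; first by lra.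
  have : 0 <= z ^+ 5 by rewrite exprn_ge0// ltW.
  lra.
by field.
Qed.

(** The two convergents confine the square of sqrt(pi n) p_n within 24 z^4 of
    the square of [central_expansion].  The difference of the squares factors
    through the sum sqrt(pi n) p_n + [central_expansion z], which is at least
    7/8, and 24 / (7/8) <= 28. *)
Lemma central_ratio_expansion (R : realType) (n : nat) (z : R) : (0 < n)%N ->
  z = 1 / (8 * n%:R) ->
  `|Num.sqrt (pi * n%:R) * central_ratio R n - central_expansion z|
    <= 28 * z ^+ 4.
Proof.
move=> n0 zE.
have n0R : 1 <= n%:R :> R by rewrite ler1n.
have z0 : 0 < z by rewrite zE divr_gt0//; lra.
have z1 : 0 <= z <= 1 / 8 by rewrite ltW//= zE ler_pdivrMr; lra.
have Q0 := central_expansion_ge z1.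
have lo := brouncker1_expansion n0R zE.
have hi := brouncker2_expansion n0R zE.
have p0 : 0 <= central_ratio R n by rewrite divr_ge0// exprn_ge0.
have pn0 : 0 <= pi * n%:R :> R by rewrite mulr_ge0 ?pi_ge0.
have x0 : 0 < 4 * n%:R + 1 :> R by lra.
have b1 : 0 < brouncker1 (4 * n%:R + 1 : R).
  by rewrite /brouncker1 addr_gt0// divr_gt0//; lra.
have b2 : 0 < brouncker2 (4 * n%:R + 1 : R).
  by rewrite brouncker2E//.
have L1 := brouncker1_lower R n0.
have L2 := brouncker2_upper R n0.
set c := Num.sqrt _ * _.
have c0 : 0 <= c by rewrite /c mulr_ge0 ?sqrtr_ge0.
have cE : c ^+ 2 = n%:R * (pi * central_ratio R n ^+ 2).
  by rewrite /c exprMn sqr_sqrtr//; ring.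
have c_lo : central_expansion z ^+ 2 - 24 * z ^+ 4 <= c ^+ 2.
  rewrite (le_trans lo)// ler_pdivrMr// cE -mulrA [4 * n%:R in leLHS]mulrC.
  by rewrite ler_wpM2l//; lra.
have c_hi : c ^+ 2 <= central_expansion z ^+ 2 + 24 * z ^+ 4.
  rewrite (le_trans _ hi)// ler_pdivlMr// cE -mulrA [4 * n%:R in leRHS]mulrC.
  by rewrite ler_wpM2l//; lra.
move: c (central_expansion z) (z ^+ 4) c0 Q0 c_lo c_hi {cE lo hi} => c q w *.
apply/ler_normlP; split; nra.
Qed.

(** * Expansion of the sum relative to its last term *)

(** The factor 3/4 makes the limit equal to 1. *)
Definition sum_ratio (R : realType) (n : nat) : R :=
  3 / 4 * (\sum_(0 <= k < n.+1) 'C(2 * k, k))%N%:R / 'C(2 * n, n)%:R.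

Lemma sum_ratio_rec (R : realType) (n : nat) :
  sum_ratio R n.+1 = 3 / 4 + (n%:R + 1) / (2 * (2 * n%:R + 1)) * sum_ratio R n.
Proof.
have b0 : 0 < 'C(2 * n, n)%:R :> R by rewrite ltr0n bin_gt0 mul2n -addnn leq_addr.
have n0 := ler0n R n.
have n1 : 0 < n.+1%:R :> R by rewrite ltr0n.
have -> : sum_ratio R n.+1 = 3 / 4 * ((\sum_(0 <= k < n.+1) 'C(2 * k, k))%N%:R
    + 'C(2 * n.+1, n.+1)%:R) / 'C(2 * n.+1, n.+1)%:R.
  by rewrite /sum_ratio big_nat_recr//= natrD.
have -> : 'C(2 * n.+1, n.+1)%:R =
    2 * (2 * n%:R + 1) * 'C(2 * n, n)%:R / (n%:R + 1) :> R.
  by rewrite -central_bin_rec natr1 mulrC mulKf// lt0r_neq0.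
rewrite /sum_ratio; field.
by do ?[apply/andP; split]; apply: lt0r_neq0; lra.
Qed.

(** Truncation of the formal solution, in y = 1/n, of the recurrence
    [sum_ratio_rec]. *)
Definition sum_expansion (R : realType) (y : R) : R :=
  1 + y / 6 + y ^+ 2 / 6 + 5 / 18 * y ^+ 3.

(** How far [sum_expansion] is from solving [sum_ratio_rec]: the coefficients of
    orders 0 to 3 cancel, leaving an explicit positive rational function. *)
Lemma sum_expansion_defect (R : realType) (n : R) : 1 <= n ->
  0 <= 3 / 4 + (n + 1) / (2 * (2 * n + 1)) * sum_expansion n^-1
       - sum_expansion (n + 1)^-1 <= 4 / (n + 1) ^+ 4.
Proof.
move=> n1.
have n2 : 1 <= n ^+ 2 by rewrite exprn_ege1.
have n23 : n ^+ 2 <= n ^+ 3 by rewrite [n ^+ 3]exprSr ler_peMr//; lra.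
have n12 : n <= n ^+ 2 by rewrite expr2 ler_peMr//; lra.
have d0 : 0 < 36 * n ^+ 3 * (n + 1) ^+ 3 * (2 * n + 1).
  by rewrite !mulr_gt0// ?exprn_gt0//; lra.
have -> : 3 / 4 + (n + 1) / (2 * (2 * n + 1)) * sum_expansion n^-1
          - sum_expansion (n + 1)^-1 =
          (5 + 23 * n + 45 * n ^+ 2 + 37 * n ^+ 3) /
          (36 * n ^+ 3 * (n + 1) ^+ 3 * (2 * n + 1)).
  rewrite /sum_expansion; field.
  by do ?[apply/andP; split]; apply: lt0r_neq0; lra.
apply/andP; split.
  by apply: divr_ge0; [lra|exact: ltW].
have m0 : 0 < (n + 1) ^+ 4 by rewrite exprn_gt0//; lra.
rewrite ler_pdivrMr// mulrAC ler_pdivlMr//.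
apply: (@le_trans _ _ (110 * n ^+ 3 * (n + 1) ^+ 4)).
  by rewrite ler_wpM2r//; [exact: ltW|lra].
have k0 : 0 <= n ^+ 3 * (n + 1) ^+ 3 by rewrite mulr_ge0// exprn_ge0//; lra.
rewrite (_ : 110 * n ^+ 3 * (n + 1) ^+ 4 =
             n ^+ 3 * (n + 1) ^+ 3 * (110 * (n + 1))); last by ring.
rewrite (_ : 4 * _ = n ^+ 3 * (n + 1) ^+ 3 * (144 * (2 * n + 1))); last by ring.
by rewrite ler_wpM2l//; lra.
Qed.

(** The error at n+1 is at most one third of the error at n plus the defect.
    The weight (n+3)^-4 rather than n^-4 makes the induction work from n = 1: it
    shrinks by at most (5/4)^4 per step, and (5/4)^4 / 3 < 1.  The constant 1000
    absorbs the defect, since 1000 (1 - (5/4)^4 / 3) exceeds 4 (5/2)^4. *)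
Lemma sum_ratio_expansion (R : realType) (n : nat) : (0 < n)%N ->
  `|sum_ratio R n - sum_expansion n%:R^-1| <= 1000 / (n%:R + 3) ^+ 4.
Proof.
case: n => // n _; elim: n => [|n IHn].
  rewrite /sum_ratio /sum_expansion unlock /= invr1 !expr1n.
  rewrite muln0 bin0 muln1 bin1 addn0.
  rewrite natrD (_ : (1 + 3) ^+ 4 = 256 :> R); last by ring.
  by apply/ler_normlP; split; lra.
rewrite sum_ratio_rec.
set m : R := n.+1%:R in IHn *.
have m1 : 1 <= m by rewrite ler1n.
have -> : n.+2%:R = m + 1 :> R by rewrite natr1.
have := sum_expansion_defect m1.
set q := (m + 1) / (2 * (2 * m + 1)); set s := sum_expansion (m + 1)^-1.
move: IHn; set r := sum_ratio R n.+1; set t := sum_expansion m^-1 => IHn D.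
have q01 : 0 <= q <= 1 / 3.
  rewrite /q divr_ge0//=; [|lra..].
  by rewrite ler_pdivrMr; lra.
have -> : 3 / 4 + q * r - s = q * (r - t) + (3 / 4 + q * t - s) by ring.
have h1 : (m + 1)^-1 <= 5 / 2 * (m + 4)^-1.
  by rewrite ler_pdivlMr ?ler_pdivrMl; lra.
have h3 : (m + 3)^-1 <= 5 / 4 * (m + 4)^-1.
  by rewrite ler_pdivlMr ?ler_pdivrMl; lra.
have -> : m + 1 + 3 = m + 4 by ring.
have H1 : (m + 1) ^- 4 <= (5 / 2) ^+ 4 * (m + 4) ^- 4.
  by rewrite -!exprVn -exprMn lerXn2r// nnegrE ?mulr_ge0// ?invr_ge0; lra.
have H3 : (m + 3) ^- 4 <= (5 / 4) ^+ 4 * (m + 4) ^- 4.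
  by rewrite -!exprVn -exprMn lerXn2r// nnegrE ?mulr_ge0// ?invr_ge0; lra.
have H0 : 0 <= (m + 4) ^- 4 by rewrite invr_ge0 exprn_ge0//; lra.
have [/andP[q0 q1] /andP[D0 D1]] := (q01, D).
have I1 : `|q * (r - t)| <= 1 / 3 * (1000 * (m + 3) ^- 4).
  by rewrite normrM (ger0_norm q0) ler_pM.
rewrite (le_trans (ler_normD _ _))// (ger0_norm D0).
lra.
Qed.

(** * Product of the two expansions *)

Lemma central_expansion_le (R : realType) (z : R) : 0 <= z <= 1 / 8 ->
  central_expansion z <= 2.
Proof.
move=> z01.
have z2 : z ^+ 2 <= z by rewrite expr2 ler_piMl//; lra.
have z3 : z ^+ 3 <= z ^+ 2 by rewrite [z ^+ 3]exprSr ler_piMr ?exprn_ge0//; lra.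
by rewrite /central_expansion; lra.
Qed.

Lemma sum_expansion_bounds (R : realType) (y : R) : 0 <= y <= 1 ->
  0 <= sum_expansion y <= 2.
Proof.
move=> y01; have [y2 y3 _] := powers_le1 y01.
by rewrite /sum_expansion; lra.
Qed.

(** The coefficients in the theorem are those of the product of the two
    expansions; the remainder has terms of orders 4 to 6 only. *)
Lemma expansion_mul (R : realType) (y : R) : 0 <= y <= 1 ->
  `|central_expansion (y / 8) * sum_expansion y
     - (1 + y / 24 + 59 / 384 * y ^+ 2 + 2425 / 9216 * y ^+ 3)| <= y ^+ 4.
Proof.
move=> y01; have [y2 y3 y4] := powers_le1 y01.
rewrite (_ : _ - _ =
  y ^+ 4 * (- (601 / 18 / 1024) + 55 / 18 / 1024 * y + 25 / 18 / 1024 * y ^+ 2)).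
  rewrite normrM ger0_norm ?ler_piMr ?exprn_ge0//; try lra.
  by apply/ler_normlP; split; lra.
by rewrite /central_expansion /sum_expansion; field.
Qed.

(** The error is split between the two factors, which are at most 3 and 2; the
    constant is 3003 = 1 + 2 * 1 + 3 * 1000. *)
Lemma product_expansion (R : realType) (n : nat) : (0 < n)%N ->
  `|Num.sqrt (pi * n%:R) * central_ratio R n * sum_ratio R n
     - (1 + 1 / (24 * n%:R) + 59 / (384 * n%:R ^+ 2)
          + 2425 / (9216 * n%:R ^+ 3))| <= 3003 * n%:R ^- 4.
Proof.
move=> n0.
have n1 : 1 <= n%:R :> R by rewrite ler1n.
have nR0 : n%:R != 0 :> R by rewrite pnatr_eq0 -lt0n.
pose y : R := n%:R^-1.
have y0 : 0 < y by rewrite invr_gt0; lra.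
have y01 : 0 <= y <= 1 by rewrite ltW//= invf_le1//; lra.
have [_ _ w01] := powers_le1 y01.
have Q2 : central_expansion (y / 8) <= 2 by apply: central_expansion_le; lra.
have Hz : y / 8 = 1 / (8 * n%:R) by rewrite /y; field.
have Hc := central_ratio_expansion n0 Hz.
rewrite (_ : 28 * (y / 8) ^+ 4 = y ^+ 4 * (28 / 8 ^+ 4)) in Hc; last by field.
have Hs : `|sum_ratio R n - sum_expansion y| <= 1000 * y ^+ 4.
  apply: (le_trans (sum_ratio_expansion R n0)).
  apply: ler_wpM2l; first exact: ler0n.
  rewrite -exprVn lerXn2r// ?nnegrE ?invr_ge0; [lra|lra|].
  by rewrite /y lef_pV2// ?posrE; lra.
have HP := expansion_mul y01.
have T2 := sum_expansion_bounds y01.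
rewrite (_ : 1 + _ + _ + _ = 1 + y / 24 + 59 / 384 * y ^+ 2
                             + 2425 / 9216 * y ^+ 3); last first.
  by rewrite /y; field.
rewrite -exprVn -/y.
have c0 : 0 <= Num.sqrt (pi * n%:R) * central_ratio R n.
  by rewrite mulr_ge0 ?sqrtr_ge0// divr_ge0// exprn_ge0.
move: c0 Hc Hs HP T2 Q2 w01.
move: (Num.sqrt _ * _) (sum_ratio R n) (central_expansion _) (sum_expansion y).
move: (y ^+ 4) (1 + _ + _ + _) => {y y0 y01 Hz n1 nR0} w p c s q t.
move=> c0 Hc Hs HP /andP[t0 t2] q2 /andP[w0 w1].
have {}Hc : `|c - q| <= w by rewrite (le_trans Hc)// ler_piMr//; lra.
have c3 : c <= 3 by have /ler_normlP[_ cq] := Hc; lra.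
(* c and s are the exact factors, q and t their truncated expansions, and p is
   the truncated product. *)
rewrite (_ : c * s - p = (q * t - p) + (c - q) * t + c * (s - t)); last by ring.
have ct : `|(c - q) * t| <= w * 2 by rewrite normrM ler_pM// ger0_norm.
have cs : `|c * (s - t)| <= 3 * (1000 * w) by rewrite normrM ler_pM// ger0_norm.
rewrite (le_trans (ler_normD _ _))//.
have := ler_normD (q * t - p) ((c - q) * t).
lra.
Qed.

Theorem theorem1 (R : realType) :
  exists2 e : nat -> R,
    e =O_\oo (fun n : nat => n%:R ^- 4 : R) &
    forall n : nat, (0 < n)%N ->
      (\sum_(0 <= k < n.+1) 'C(2 * k, k))%N%:R =
        4 ^+ n.+1 / (3 * Num.sqrt (pi * n%:R))
          * (1 + 1 / (24 * n%:R) + 59 / (384 * n%:R ^+ 2)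
               + 2425 / (9216 * n%:R ^+ 3) + e n) :> R.
Proof.
pose P (n : nat) : R := 1 + 1 / (24 * n%:R) + 59 / (384 * n%:R ^+ 2)
               + 2425 / (9216 * n%:R ^+ 3).
pose c n := Num.sqrt (pi * n%:R) * central_ratio R n.
exists (fun n => c n * sum_ratio R n - P n).
  apply/eqO_exP; exists 3003; first by rewrite ltr0n.
  exists 1%N => // n /= n0.
  rewrite [leRHS](_ : _ = 3003 * n%:R ^- 4); first exact: product_expansion.
  by rewrite ger0_norm// invr_ge0 exprn_ge0.
move=> n n0.
have n0R : 0 < n%:R :> R by rewrite ltr0n.
rewrite -/(P n) addrC subrK /c /sum_ratio /central_ratio exprS.
have s0 : 0 < Num.sqrt (pi * n%:R : R) by rewrite sqrtr_gt0 mulr_gt0 ?pi_gt0.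
have b0 : 0 < 'C(2 * n, n)%:R :> R by rewrite ltr0n bin_gt0 mul2n -addnn leq_addr.
field.
by rewrite !lt0r_neq0// exprn_gt0.
Qed.
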